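(* For any SDS $K\subseteq\mathcal P(\mathcal T)$: (i) $K$ is consistent if and only if $E(K)=\{D\in\overline{\mathbf D}:K\subseteq K_D\}\neq\emptyset$; (ii) $\mathrm{cl}_{\mathbf K}(K)=\bigcap_{D\in\overline{\mathbf D}:\ K\subseteq K_D}K_D$; (iii) $K$ is coherent if and only if $K$ is consistent and $K=\bigcap_{D\in\overline{\mathbf D}:\ K\subseteq K_D}K_D$.
   Context: Let $\mathcal T$ be a non-empty set (of ''things''), $\mathrm{cl}:\mathcal P(\mathcal T)\to\mathcal P(\mathcal T)$ a closure operator (extensive, monotone, idempotent), $\mathcal T_-\subseteq\mathcal T$ a set of forbidden things, $\mathcal T_+:=\mathrm{cl}(\emptyset)$, with standing assumption $\mathcal T_+\cap\mathcal T_-=\emptyset$. A coherent SDT is a $D\subseteq\mathcal T$ with $\mathrm{cl}(D)=D$ and $D\cap\mathcal T_-=\emptyset$; $\overline{\mathbf D}$ is the set of all coherent SDTs. For $\mathcal W\subseteq\mathcal P(\mathcal T)$, $\Sigma_{\mathcal W}$ is the set of maps $\sigma:\mathcal W\to\mathcal T$ with $\sigma(S)\in S$ for all $S\in\mathcal W$, and $\sigma(\mathcal W):=\{\sigma(S):S\in\mathcal W\}$. An SDS is any $K\subseteq\mathcal P(\mathcal T)$. It is coherent if (K1) $\emptyset\notin K$; (K2) if $S_1\in K$ and $S_1\subseteq S_2\subseteq\mathcal T$ then $S_2\in K$; (K3) if $S\in K$ then $S\setminus\mathcal T_-\in K$; (K4) $\{t\}\in K$ for all $t\in\mathcal T_+$;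 (K5) for every non-empty $\mathcal W\subseteq K$ and every family $(t_\sigma)_{\sigma\in\Sigma_{\mathcal W}}$ with $t_\sigma\in\mathrm{cl}(\sigma(\mathcal W))$, $\{t_\sigma:\sigma\in\Sigma_{\mathcal W}\}\in K$. An SDS is consistent if it is included in some coherent SDS. $\mathrm{cl}_{\mathbf K}(K)$ is the intersection of all coherent SDSes including $K$, which is $\mathcal P(\mathcal T)$ if there are none. For $D\subseteq\mathcal T$ let $K_D:=\{S\subseteq\mathcal T:S\cap D\neq\emptyset\}$. For $S\subseteq\mathcal T$ let $\overline{\mathbf D}_S:=\{D\in\overline{\mathbf D}:S\cap D\neq\emptyset\}$ and $E(\mathcal W):=\bigcap_{S\in\mathcal W}\overline{\mathbf D}_S$ (with $E(\emptyset)=\overline{\mathbf D}$). An intersection over an empty family of $K_D$'s is taken to be $\mathcal P(\mathcal T)$. *)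

(* Defs.v *)
From mathcomp Require Import all_boot.
From mathcomp Require Import boolp classical_sets.

Set Implicit Arguments.
Unset Strict Implicit.
Unset Printing Implicit Defensive.

Local Open Scope classical_set_scope.

(* The set of things is a type T, sets of things are terms of type set T, and
   sets of desirable sets (SDSes) are terms of type set (set T).  In what
   follows, cl is the closure operator and Tm the set of forbidden things;
   cl set0 is the set of things that are always desirable. *)

Definition closure_operator (T : Type) (cl : set T -> set T) : Prop :=
  [/\ forall A, A `<=` cl A,
      forall A B, A `<=` B -> cl A `<=` cl B
    & forall A, cl (cl A) = cl A].

Definition coherent_SDT (T : Type) (cl : set T -> set T) (Tm : set T) :
    set (set T) :=
  [set D | cl D = D /\ D `&` Tm = set0].

(* W is coerced to the subtype of its elements, so that a selection is defined
   on W only. *)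
Definition selections (T : Type) (W : set (set T)) : set (W -> T) :=
  [set s | forall S : W, val S (s S)].

Arguments selections {T} W.

(* In the last clause, a family indexed by the selections is represented by a
   function t on all maps W -> T, of which only the values at selections
   matter; when T is inhabited every such family has this form. *)
Record coherent_SDS (T : Type) (cl : set T -> set T) (Tm : set T)
    (K : set (set T)) : Prop := CoherentSDS {
  SDS_nonempty : ~ K set0;
  SDS_up : forall S1 S2 : set T, K S1 -> S1 `<=` S2 -> K S2;
  SDS_setD : forall S : set T, K S -> K (S `\` Tm);
  SDS_plus : forall x : T, cl set0 x -> K [set x];
  SDS_production : forall W : set (set T), W !=set0 -> W `<=` K ->
    forall t : (W -> T) -> T,
      (forall s : W -> T, selections W s -> cl (range s) (t s)) ->
      K (t @` selections W)
}.

Definition consistent_SDS (T : Type) (cl : set T -> set T) (Tm : set T)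
    (K : set (set T)) : Prop :=
  exists K' : set (set T), coherent_SDS cl Tm K' /\ K `<=` K'.

Definition cl_SDS (T : Type) (cl : set T -> set T) (Tm : set T)
    (K : set (set T)) : set (set T) :=
  \bigcap_(K' in [set K' | coherent_SDS cl Tm K' /\ K `<=` K']) K'.

Definition SDS_of_SDT (T : Type) (D : set T) : set (set T) :=
  [set S | S `&` D !=set0].

Definition SDT_meeting (T : Type) (cl : set T -> set T) (Tm : set T)
    (S : set T) : set (set T) :=
  [set D | coherent_SDT cl Tm D /\ S `&` D !=set0].

(* The explicit intersection with coherent_SDT only matters for W = set0: the
   intersection of no sets is then taken within the coherent SDTs. *)
Definition events (T : Type) (cl : set T -> set T) (Tm : set T)
    (W : set (set T)) : set (set T) :=
  coherent_SDT cl Tm `&` \bigcap_(S in W) SDT_meeting cl Tm S.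

Definition dominating_SDT (T : Type) (cl : set T -> set T) (Tm : set T)
    (K : set (set T)) : set (set T) :=
  [set D | coherent_SDT cl Tm D /\ K `<=` SDS_of_SDT D].

(* Main.v *)
(* The point is that a coherent SDS K is the intersection of the K_D including
   it: every S outside K is missed by some D in the intersection. Otherwise,
   for each selection s of K, either cl (range s) is a coherent SDT, whose K_D
   includes K, and then it meets S by assumption, or it meets the forbidden set
   Tm. So each cl (range s) contains some t s in S or in Tm; the production
   axiom puts the set of all the t s in K, and after removal of Tm it is a
   subset of S, so that S is in K. Conversely, every K_D is coherent, and so is
   every intersection of at least one coherent SDS. *)
Require Import Defs.
From mathcomp Require Import all_boot.
From mathcomp Require Import boolp classical_sets.

Local Open Scope classical_set_scope.

Lemma selections_exists {T : Type} (W : set (set T)) (D : set T) :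
  W `<=` SDS_of_SDT D ->
  exists2 s : W -> T, selections W s & range s `<=` D.
Proof.
move=> WD.
have /choice[s sP] : forall S : W, exists x, (val S `&` D) x.
  by move=> S; apply: WD; exact: set_valP.
exists s; first by move=> S; case: (sP S).
by move=> _ [S _ <-]; case: (sP S).
Qed.

(** Each [S] in [W] contains its own selected value [s S], which lies in [range s]. *)
Lemma selections_SDS_of_SDT {T : Type} (W : set (set T)) (s : W -> T) :
  selections W s -> W `<=` SDS_of_SDT (range s).
Proof.
move=> sW S WS; pose S' : W := SigSub (mem_set WS).
by exists (s S'); split; [exact: (sW S')|exists S'].
Qed.

Lemma SDS_of_SDT_subset {T : Type} (D1 D2 : set T) :
  D1 `<=` D2 -> SDS_of_SDT D1 `<=` SDS_of_SDT D2.
Proof. by move=> D12 S [x [Sx /D12 D2x]]; exists x. Qed.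

Lemma coherent_SDS_of_SDT {T : Type} (cl : set T -> set T) (Tm D : set T) :
  closure_operator cl -> coherent_SDT cl Tm D ->
  coherent_SDS cl Tm (SDS_of_SDT D).
Proof.
move=> [_ cl_mono _] [clD DTm]; split.
- by case=> x [].
- by move=> S1 S2 [x [S1x Dx]] S12; exists x; split => //; exact: S12.
- move=> S [x [Sx Dx]]; exists x; split=> //; split=> // Tmx.
  by have : (D `&` Tm) x by []; rewrite DTm.
- move=> x /(cl_mono _ _ (sub0set D)); rewrite clD => Dx.
  by exists x.
(* A single selection with values in [D] suffices: as [D] is closed, [cl (range s)] and hence [t s]
   stay in [D]. *)
- move=> W _ /selections_exists[s sW sD] t tP; exists (t s).
  by split; [exists s|rewrite -clD; exact: cl_mono (tP s sW)].
Qed.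

Lemma coherent_SDS_bigcap {T : Type} (cl : set T -> set T) (Tm : set T)
    (I : Type) (P : set I) (F : I -> set (set T)) :
  P !=set0 -> (forall i, P i -> coherent_SDS cl Tm (F i)) ->
  coherent_SDS cl Tm (\bigcap_(i in P) F i).
Proof.
move=> [i0 Pi0] Fcoh; split.
(* An intersection over no index would contain [set0]; the index [i0] rules this out. *)
- by move=> /(_ i0 Pi0); exact: SDS_nonempty (Fcoh i0 Pi0).
- by move=> S1 S2 FS1 S12 i Pi; exact: (SDS_up (Fcoh i Pi)) (FS1 i Pi) S12.
- by move=> S FS i Pi; exact: (SDS_setD (Fcoh i Pi)) (FS i Pi).
- by move=> x x0 i Pi; exact: (SDS_plus (Fcoh i Pi)).
- move=> W W0 WF t tP i Pi; apply: (SDS_production (Fcoh i Pi)) => //.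
  by move=> S /WF; exact.
Qed.

Lemma dominating_SDT_anti {T : Type} (cl : set T -> set T) (Tm : set T)
    (K1 K2 : set (set T)) :
  K1 `<=` K2 -> dominating_SDT cl Tm K2 `<=` dominating_SDT cl Tm K1.
Proof. by move=> K12 D [cohD K2D]; split => //; exact: subset_trans K2D. Qed.

Lemma events_dominating_SDT {T : Type} (cl : set T -> set T) (Tm : set T)
    (K : set (set T)) : events cl Tm K = dominating_SDT cl Tm K.
Proof.
apply/seteqP; split=> D [cohD KD]; split=> // S KS; first by case: (KD S KS).
by split=> //; exact: KD.
Qed.

(** All three parts of the theorem rest on this inclusion, applied to [K] itself or to a coherent
    SDS including it. *)
Lemma coherent_SDS_bigcap_sub {T : Type} (cl : set T -> set T) (Tm : set T)
    (K : set (set T)) : closure_operator cl -> coherent_SDS cl Tm K ->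
  \bigcap_(D in dominating_SDT cl Tm K) SDS_of_SDT D `<=` K.
Proof.
move=> [cl_ext _ cl_idem] cohK S SD.
have [K0|/set0P[S0 KS0]] := eqVneq K set0.
  (* The production axiom says nothing here, but set0 is a coherent SDT. *)
  have cl0 : cl set0 = set0.
    by apply/seteqP; split=> // x /(SDS_plus cohK); rewrite K0.
  have [|x []//] := SD set0.
  by split; [split; [|rewrite set0I]|rewrite K0; exact: sub0set].
have /choice[t tP] : forall s : K -> T, exists x,
    selections K s -> cl (range s) x /\ (S `|` Tm) x.
  move=> s; have [sK|nsK] := pselect (selections K s); last first.
    (* Off the selections the condition on [x] is void, but [choice] still asks for some thing: the
       value of [s] at [S0]. *)
    by exists (s (SigSub (mem_set KS0))).
  have [clTm|/set0P[x [clx Tmx]]] := eqVneq (cl (range s) `&` Tm) set0.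
    have [|x [Sx clx]] := SD (cl (range s)).
      split; first by split.
      apply: subset_trans (selections_SDS_of_SDT _ _ sK) _.
      exact/SDS_of_SDT_subset/cl_ext.
    by exists x => _; split => //; left.
  by exists x => _; split => //; right.
have Kt : K (t @` selections K).
  apply: (SDS_production cohK) => //; first by exists S0.
  by move=> s /tP[].
apply: (SDS_up cohK) (SDS_setD cohK Kt) _.
by move=> _ [[s /tP[_ []]] // Tmx <-].
Qed.

Theorem theorem9 (T : Type) (cl : set T -> set T) (Tm : set T)
    (T_nonempty : [set: T] !=set0)
    (cl_closure : closure_operator cl)
    (plus_minus_disjoint : cl set0 `&` Tm = set0)
    (K : set (set T)) :
  [/\ events cl Tm K = dominating_SDT cl Tm K /\
      (consistent_SDS cl Tm K <-> events cl Tm K !=set0),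
      cl_SDS cl Tm K = \bigcap_(D in dominating_SDT cl Tm K) SDS_of_SDT D
    & coherent_SDS cl Tm K <->
      consistent_SDS cl Tm K /\
      K = \bigcap_(D in dominating_SDT cl Tm K) SDS_of_SDT D].
Proof.
have consistentP : consistent_SDS cl Tm K <-> dominating_SDT cl Tm K !=set0.
  split=> [[K' [cohK' KK']]|[D [cohD KD]]]; last first.
    by exists (SDS_of_SDT D); split=> //; exact: coherent_SDS_of_SDT.
  (* If no [D] dominates [K], none dominates [K']; the intersection for [K'] is then everything, so
     [set0] would be in [K']. *)
  apply/set0P/eqP => domK0; apply: (SDS_nonempty cohK').
  apply: (coherent_SDS_bigcap_sub _ _ _ cl_closure cohK').
  by move=> D /(dominating_SDT_anti _ _ _ _ KK'); rewrite domK0.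
split.
- by rewrite events_dominating_SDT.
- apply/seteqP; split=> S KS.
    move=> D [cohD KD]; apply: KS; split=> //.
    exact: coherent_SDS_of_SDT.
  (* The larger [K'] has fewer dominating [D], so [S] lies in the intersection for [K'], which is
     included in [K']. *)
  move=> K' [cohK' KK'].
  apply: (coherent_SDS_bigcap_sub _ _ _ cl_closure cohK') => D domD.
  exact: KS (dominating_SDT_anti _ _ _ _ KK' _ domD).
- split=> [cohK|[/consistentP domK0 ->]].
    split; first by exists K; split.
    apply/seteqP; split; last exact: coherent_SDS_bigcap_sub.
    by move=> S KS D [_]; exact.
  apply: coherent_SDS_bigcap => // D [cohD _].
  exact: coherent_SDS_of_SDT.
Qed.
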